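(* Let $G$ be a group and let $a\in G$ be a strong left $3$-Engel element of $G$. Then the normal closure $\langle a\rangle^{G}$ of $a$ in $G$ is locally nilpotent.
   Context: For group elements $x,g$ write $x^g=g^{-1}xg$. An element $a$ of a group $G$ is called a strong left $3$-Engel element of $G$ if: (1) $\langle a,a^{g}\rangle$ is nilpotent of class at most $2$ for all $g\in G$; and (2) $\langle a,a^{f},a^{g}\rangle$ is nilpotent of class at most $3$ for all $f,g\in G$. Here $\langle a\rangle^{G}$ denotes the normal closure of $\langle a\rangle$ in $G$. A group is locally nilpotent if each of its finitely generated subgroups is nilpotent. *)

(* Defs.v *)
From HB Require Import structures.
From mathcomp Require Import all_boot.
From mathcomp Require Import boolp classical_sets cardinality.

Set Implicit Arguments.
Unset Strict Implicit.
Unset Printing Implicit Defensive.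

Local Open Scope classical_set_scope.
Local Open Scope group_scope.

Section Subgroups.
Variable G : groupType.
Implicit Types (H K N : set G) (A : set G).

Definition is_subgroup H : Prop :=
  [/\ H 1, forall x y, H x -> H y -> H (x * y) & forall x, H x -> H x^-1].

Definition is_normal_subgroup N : Prop :=
  is_subgroup N /\ forall x g, N x -> N (x ^ g).

Definition subgroup_gen A : set G := smallest is_subgroup A.

Definition normal_closure A : set G := smallest is_normal_subgroup A.

Definition commutator_subgroup H K : set G :=
  subgroup_gen [set [~ x, y] | x in H & y in K].

(* Indexing starts at 0: [lower_central H n] is gamma_(n+1)(H). *)
Fixpoint lower_central H (n : nat) : set G :=
  if n is m.+1 then commutator_subgroup (lower_central H m) H else H.

Definition nilpotent_class_le (c : nat) H : Prop :=
  lower_central H c = [set 1].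

Definition is_nilpotent H : Prop := exists c, nilpotent_class_le c H.

Definition finitely_generated H : Prop :=
  exists2 A, finite_set A & H = subgroup_gen A.

Definition locally_nilpotent H : Prop :=
  forall K, is_subgroup K -> K `<=` H -> finitely_generated K -> is_nilpotent K.

Definition strong_left_3_Engel (a : G) : Prop :=
  (forall g : G, nilpotent_class_le 2 (subgroup_gen [set a; a ^ g])) /\
  (forall f g : G, nilpotent_class_le 3 (subgroup_gen [set a; a ^ f; a ^ g])).

End Subgroups.

(* Main.v *)
Require Import Defs.
From mathcomp Require Import all_boot.
From mathcomp Require Import boolp classical_sets cardinality.

(** Why the normal closure of [a] is locally nilpotent.

Call a set [S] of group elements strong if it is closed under conjugation and
inversion and if, for [x], [y], [z] in [S], the element [x] commutes with
[x ^ y] and [x ^ y] commutes with [x ^ z]. The two bounds on nilpotency classes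
make the set of conjugates of [a] and of their inverses strong
([strong_conjugates]). This set generates a normal subgroup containing [a], and
finitely many elements of the normal closure involve only finitely many of the
generators, so it suffices that finitely many elements of a strong set always
generate a nilpotent group ([strong_locally_nilpotent]).

The first ingredient is group-theoretic: adding to a strong set the commutators
of its elements yields a strong set again ([strong_add_commutators]). Hence the
generators lie in a strong set [T] that is closed under commutators. For [d],
[e], [t] in [T] two left-normed commutators vanish, [[~ d, e, e] = 1] and
[[~ d, e, t, e] = 1], and a truncated Jacobi identity holds: modulo a normal
subgroup that contains [[~ d, y]], the elements [[~ d, [~ x, y]]] and
[[~ d, x, y]] agree ([jacobi_hypercenter]).

The second ingredient is combinatorial. Let [H] be generated by finitely many
elements of [T], the letters, and let [Z] be the union of the upper central
series of [H]. Suppose that some [d] in [T] and [H] is not in [Z]. An element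
whose commutators with all letters lie in [Z] is itself in [Z], so one can form
[[~ d, i1, i2, ...]] forever without entering [Z]; always choose the largest
possible letter. The words produced in this way, from all such [d], are closed
under factors and can be prolonged on the right. By the choice of the letters,
any word that is larger than such a word at the first difference sends [d] into
[Z]. Therefore, if [u] is a Lyndon word, all terms but one disappear when its
iterated bracketing [t] is expanded, and [[~ d, t]] equals [[~ d, u1, ..., uk]]
modulo [Z] ([lyndon_bracket]). On the other hand, the least infinite word of a
uniformly recurrent language shows that every language of this kind contains
[e e], or [b e b], or [e u e], for a letter [e] and Lyndon words [b], [u]
([unavoidable_pattern]). Up to elements of [Z], the commutator along such a word
is [[~ d, e, e]], [[~ d, t, e, t]] or [[~ d, e, t, e]], which is trivial, a
contradiction. So the letters lie in [Z], and [H], being finitely generated, is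
nilpotent. *)

Set Implicit Arguments.
Unset Strict Implicit.
Unset Printing Implicit Defensive.

Local Open Scope classical_set_scope.
Local Open Scope group_scope.

(** Proves identities of words in the free group by cancelling inverses. *)
Ltac group_id :=
  rewrite /commg /conjg; repeat rewrite invgM; rewrite ?invgK ?mulgA;
  repeat (rewrite ?mulgK ?mulgVK ?mulVg ?mulgV ?mul1g ?mulg1 ?invg1).

(** * Commutation and commutators *)

Section Commuting.
Variable G : groupType.
Implicit Types x y z g h : G.

Lemma commuteVl x y : commute x y -> commute x^-1 y.
Proof. by move=> /commute_sym/commuteV/commute_sym. Qed.

Lemma commuteMl x y z : commute x z -> commute y z -> commute (x * y) z.
Proof. by move=> /commute_sym xz /commute_sym yz; exact/commute_sym/commuteM. Qed.

Lemma commute_divl x y z :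
  commute x z -> commute y z -> commute (x^-1 * y) z.
Proof. by move=> xz yz; exact: commuteMl (commuteVl xz) yz. Qed.

Lemma commute_divr x y z :
  commute z x -> commute z y -> commute z (x^-1 * y).
Proof. by move=> xz yz; exact: commuteM (commuteV xz) yz. Qed.

Lemma commuteJ x y g : commute x y -> commute (x ^ g) (y ^ g).
Proof. by move=> xy; rewrite /commute -!conjMg xy. Qed.

Lemma commuteJV x y g : commute (x ^ g^-1) y -> commute x (y ^ g).
Proof. by move=> /(@commuteJ _ _ g); rewrite conjgKV. Qed.

Lemma commuteJl x y g : commute x (y ^ g^-1) -> commute (x ^ g) y.
Proof. by move=> /(@commuteJ _ _ g); rewrite conjgKV. Qed.

Lemma commute_conj x y : commute x y -> x ^ y = x.
Proof. by move=> xy; rewrite conjgE xy mulKg. Qed.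

Lemma conj_commute x y : x ^ y = x -> commute x y.
Proof. by move=> xy; rewrite /commute conjgC xy. Qed.

Lemma commuteR x y z : commute x z -> commute y z -> commute [~ x, y] z.
Proof.
move=> xz yz; rewrite commgEl conjgE.
by do ?[apply: commuteMl | apply: commuteVl].
Qed.

Lemma commgE2 g x : [~ g, x] = (x ^ g)^-1 * x.
Proof. by rewrite commgEr conjVg. Qed.

Lemma commgMl x y z : [~ x * y, z] = [~ x, z] ^ y * [~ y, z].
Proof. by group_id. Qed.

Lemma commgMr x y z : [~ x, y * z] = [~ x, z] * [~ x, y] ^ z.
Proof. by group_id. Qed.

Lemma commgVl x y : [~ x^-1, y] = [~ x, y]^-1 ^ x^-1.
Proof. by group_id. Qed.

Lemma commgVr x y : [~ x, y^-1] = [~ x, y]^-1 ^ y^-1.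
Proof. by group_id. Qed.

Lemma conjg_mulR x y : x ^ y = x * [~ x, y].
Proof. by group_id. Qed.

End Commuting.

(** * Strong sets *)

Section StrongSet.
Variable G : groupType.
Implicit Types (S : set G) (a b c d e f g h k p q t u v w x y z : G).

Definition strong_set S :=
  [/\ forall x g, S x -> S (x ^ g), forall x, S x -> S x^-1,
      forall x y, S x -> S y -> commute x (x ^ y) &
      forall x y z, S x -> S y -> S z -> commute (x ^ y) (x ^ z)].

(** Conjugation by a tame element obeys the commutation rules that conjugation
by elements of [S] obeys. A thin element acts on each member of [S] as
[u - 1 + v] would act additively, with [u], [v] in [S]; commutation with
[x ^ t] then reduces to commutation with [x ^ u], [x] and [x ^ v]. *)
Definition tame S g := forall x, S x ->
  commute x (x ^ g) /\ forall y, S y -> commute (x ^ g) (x ^ y).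

Definition thin S t := forall x, S x ->
  exists u v, [/\ S u, S v & x ^ t = x ^ u * x^-1 * x ^ v].

(** This is why commutators are thin: [[~ g, x]] is the quotient
[(x ^ g)^-1 * x] of two members of a strong set. *)
Lemma conj_div x y e : commute y x -> commute y (x ^ e) ->
  e ^ (y^-1 * x) = e ^ y^-1 * e^-1 * e ^ x.
Proof.
move=> yx yxe.
have c1 : commute [~ e, x] y^-1.
  by apply: commuteV; rewrite commgE2; apply: commuteMl;
    [apply: commuteVl; exact: commute_sym | exact: commute_sym].
have -> : y^-1 * x = x * y^-1 by apply/commuteVl.
rewrite conjgM {1}(conjg_mulR e x) conjMg (commute_conj c1) commgEl.
by rewrite mulgA.
Qed.

Variable S : set G.
Hypothesis sS : strong_set S.

Let SJ x g : S x -> S (x ^ g). Proof. by case: sS => + _ _ _; apply. Qed.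
Let SV x : S x -> S x^-1. Proof. by case: sS => _ + _ _; apply. Qed.
Let S1 x y : S x -> S y -> commute x (x ^ y).
Proof. by case: sS => _ _ + _; apply. Qed.
Let S2 x y z : S x -> S y -> S z -> commute (x ^ y) (x ^ z).
Proof. by case: sS => _ _ _; apply. Qed.

Lemma tame_mem x : S x -> tame S x.
Proof. by move=> Sx y Sy; split; [exact: S1|move=> z Sz; exact: S2]. Qed.

(** Thinness of one side and tameness of the other give commutation of the two
conjugates: each of the three factors of [x ^ t] commutes with [x ^ h]. *)
Lemma thin_commute t h x : thin S t -> tame S h -> S x ->
  commute (x ^ t) (x ^ h).
Proof.
move=> tt th Sx; have [u [v [Su Sv ->]]] := tt x Sx.
have [xh xhy] := th x Sx.
apply: commuteMl; last exact/commute_sym/xhy.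
by apply: commuteMl; [exact/commute_sym/xhy | exact: commuteVl].
Qed.

Lemma thin_tame t : thin S t -> tame S t.
Proof.
move=> tt x Sx; split; last by move=> y /tame_mem ty; exact: thin_commute.
have [u [v [Su Sv ->]]] := tt x Sx.
apply: commuteM; last exact: S1.
by apply: commuteM; [exact: S1 | exact/commuteV/commute_refl].
Qed.

Lemma thin_commg g x : tame S g -> S x -> thin S [~ g, x].
Proof.
move=> tg Sx e Se; have [xg xge] := tg x Sx.
exists (x ^ g)^-1, x; split=> //; first exact/SV/SJ.
rewrite commgE2; apply: conj_div; first exact: commute_sym.
exact: xge.
Qed.

Lemma thin_commgV g x : tame S g -> S x -> thin S [~ g, x]^-1.
Proof.
move=> tg Sx e Se; have [xg xge] := tg x Sx.
exists x^-1, (x ^ g); split=> //; [exact/SV|exact/SJ|].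
rewrite commgE2 invgM invgK; apply: conj_div => //.
have := commuteJ e (xge _ (SV Se)); rewrite conjgKV => /commute_sym.
by [].
Qed.

Lemma commg_commute g h x : commute x (x ^ g) -> commute x (x ^ h) ->
  commute (x ^ g) (x ^ h) -> commute [~ g, x] [~ h, x].
Proof.
move=> xg xh gh; rewrite !commgE2.
apply: commute_divl; apply: commute_divr => //; exact: commute_sym.
Qed.

Lemma commg_commute_conj k a r : thin S k -> S a -> tame S r ->
  commute [~ k, a] (a ^ r).
Proof.
move=> tk Sa tr; rewrite commgE2; apply: commute_divl.
  exact: thin_commute.
by have [] := tr a Sa.
Qed.

Lemma commg_commuter k a : tame S k -> S a -> commute [~ k, a] a.
Proof.
move=> tk Sa; rewrite commgE2; apply: commute_divl => //.
by have [/commute_sym] := tk a Sa.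
Qed.

(** Since [q] commutes with [b], and [[~ q, w]] with both [[~ w, b]] and
[[~ q, [~ w, b]]], conjugating [[~ q, w]] by [b] gives
[[~ q, w, b] = [~ q, [~ w, b]]]; the right-hand side is [q^-1] times a conjugate
of [q] by a tame element, and both commute with [a]. *)
Lemma double_commg_commute q a b w : thin S q -> S a -> S b -> S w ->
  commute q a -> (forall r, tame S r -> commute q (a ^ r)) -> commute q b ->
  commute [~ q, w, b] a.
Proof.
move=> tq Sa Sb Sw qa qar qb.
pose h := [~ w, b]; pose y := [~ q, w].
have [wq wqx] := thin_tame tq Sw.
have wb : commute w (w ^ b) by exact: S1.
have Ey : y = (w ^ q)^-1 * w by rewrite /y commgE2.
have yh : commute y h.
  rewrite Ey; apply: commute_divl; apply: commute_divr => //.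
  - exact: wqx.
have qhy : commute [~ q, h] y.
  rewrite commgE2; apply: commute_divl; last exact: commute_sym.
  rewrite /h commgEl conjMg conjVg Ey.
  apply: commute_divl; apply: commute_divr => //.
  - exact/commute_sym/commuteJ.
  - rewrite -conjgM -qb conjgM; apply: commuteJl; exact/wqx/SV.
have Eyb : y ^ b = [~ q, h] * y.
  rewrite conjRg (commute_conj qb) (conjg_mulR w b) commgMr.
  by rewrite (commute_conj yh).
have -> : [~ q, w, b] = [~ q, h] by rewrite commgEl Eyb qhy mulKg.
rewrite commgEl; apply: commute_divl => //; apply: commuteJl; apply: qar.
by rewrite /h invgR; apply/thin_tame/thin_commg => //; exact: tame_mem.
Qed.

Lemma thin_commg_mem x y : S x -> S y -> thin S [~ x, y].
Proof. by move=> Sx Sy; apply: thin_commg => //; apply: tame_mem. Qed.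

Lemma tame_commg_mem x y : S x -> S y -> tame S [~ x, y].
Proof. by move=> Sx Sy; apply/thin_tame/thin_commg_mem. Qed.

(** In the associated Lie ring this is the vanishing of every bracket of four
elements of [S] in which the last entry repeats an earlier one. *)
Lemma commg3_commute x y z : S x -> S y -> S z ->
  [/\ commute [~ x, y, z] x, commute [~ x, y, z] y & commute [~ x, y, z] z].
Proof.
move=> Sx Sy Sz; split; last by apply: commg_commuter => //; exact: tame_commg_mem.
- rewrite commgEl; apply: commute_divl.
    by rewrite -invgR; apply: commuteVl; apply: commg_commuter => //; exact: tame_mem.
  apply: commuteJl; rewrite commgEl; apply: commute_divl.
    exact/S1/SV.
  exact/S2/SV.
- have xyy : commute [~ x, y] y by apply: commg_commuter => //; exact: tame_mem.
  rewrite commgEl; apply: commute_divl => //.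
  apply: commuteJl; rewrite commgE2; apply: commute_divl.
    exact/S2/SV.
  exact/S1/SV.
Qed.

(** The Jacobi identity holds exactly: expand [[~ a, b * z]] directly and through
[b * z = z * b * [~ b, z]]; all factors involved commute with each other. *)
Lemma jacobi_commg a b z : S a -> S b -> S z -> [~ a, b, z] = [~ b, z, a]^-1 * [~ a, z, b].
Proof.
move=> Sa Sb Sz; set k := [~ b, z].
have [q2b q2z q2a] := commg3_commute Sb Sz Sa.
have [q1a q1z q1b] := commg3_commute Sa Sz Sb.
have E1 : [~ a, b * z] = [~ a, z] * ([~ a, b] * [~ a, b, z]).
  by rewrite commgMr (conjg_mulR [~ a, b]).
have E2 : [~ a, b * z] = [~ a, k] * ([~ a, b] * ([~ a, z] * [~ a, z, b])) ^ k.
  by rewrite -(conjg_mulR [~ a, z]) -commgMr -commgMr /k -commgC.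
have abk : commute [~ a, b] k.
  rewrite /k -(invgR z b); apply: commuteV; apply: commg_commute;
    [exact: S1 | exact: S1 | exact: S2].
have azk : commute [~ a, z] k by apply: commg_commute; [exact: S1 | exact: S1 | exact: S2].
have abz : commute [~ a, b] [~ a, z].
  rewrite -[[~ a, b]]invgR -[[~ a, z]]invgR; apply: commuteVl; apply: commuteV.
  by apply: commg_commute; [exact: S1 | exact: S1 | exact: S2].
have q1k : commute [~ a, z, b] k by apply/commute_sym/commuteR; exact: commute_sym.
have q2ab : commute [~ k, a] [~ a, b] by apply/commute_sym/commuteR; exact: commute_sym.
have q2az : commute [~ k, a] [~ a, z] by apply/commute_sym/commuteR; exact: commute_sym.
move: E2; rewrite E1 commute_conj; last exact: (commuteMl abk (commuteMl azk q1k)).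
rewrite -[[~ a, k]]invgR.
have q2c : commute [~ k, a]^-1 ([~ a, z] * [~ a, b]).
  exact: commuteVl (commuteM q2az q2ab).
rewrite (mulgA [~ a, b] [~ a, z]) abz (mulgA [~ k, a]^-1) q2c.
rewrite -(mulgA ([~ a, z] * [~ a, b])) -(mulgA [~ a, z]).
by move=> /mulgI/mulgI.
Qed.

(** With [g = [~ a, b, z, w]], the next lemmas show that [[~ g, a]] commutes with
[b] and [[~ g, b]] with [a]. By [jacobi_commg], [g] is [[~ q2^-1 * q1, w]]; only
one of the two factors contributes to each of these commutators, because the
other yields an element commuting with [a], respectively [b]. *)
Section Commutator.
Variables a b z w : G.
Hypotheses (Sa : S a) (Sb : S b) (Sz : S z) (Sw : S w).

Let q1 := [~ a, z, b].
Let q2 := [~ b, z, a].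
Let g := [~ a, b, z, w].

Let taz : thin S [~ a, z]. Proof. exact: thin_commg_mem. Qed.
Let tbz : thin S [~ b, z]. Proof. exact: thin_commg_mem. Qed.
Let q1a : commute q1 a. Proof. by have [] := commg3_commute Sa Sz Sb. Qed.
Let q1b : commute q1 b. Proof. by have [] := commg3_commute Sa Sz Sb. Qed.
Let q2a : commute q2 a. Proof. by have [] := commg3_commute Sb Sz Sa. Qed.
Let q2b : commute q2 b. Proof. by have [] := commg3_commute Sb Sz Sa. Qed.

Lemma commg_commg_commute k c v : thin S k -> S c -> S v ->
  commute [~ k, c] c -> commute [~ [~ k, c], v] c.
Proof.
move=> tk Sc Sv kc; rewrite commgEl; apply: commute_divl => //.
by apply/commuteJl/commg_commute_conj => //; exact/tame_mem/SV.
Qed.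

Lemma commg_commgV_commute k c v : thin S k -> S c -> S v ->
  commute [~ k, c] c -> commute [~ [~ k, c]^-1, v] c.
Proof.
move=> tk Sc Sv kc; rewrite commgEl conjVg.
apply: commute_divl; apply: commuteVl => //.
by apply/commuteJl/commg_commute_conj => //; exact/tame_mem/SV.
Qed.

Lemma commg_left_commute : commute [~ g, a] b.
Proof.
have h0a : commute ([~ q2^-1, w] ^ q1) a.
  by apply/commuteJl; rewrite commute_conj;
    [exact: commg_commgV_commute | exact/commuteV/commute_sym].
have -> : [~ g, a] = [~ q1, w, a].
  rewrite /g (jacobi_commg Sa Sb Sz) -/q1 -/q2 (commgMl q2^-1 q1) (commgMl ([~ q2^-1, w] ^ q1)).
  by move/commgP/eqP: h0a => ->; rewrite conj1g mul1g.
apply: double_commg_commute => //.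
- by apply: thin_commg => //; exact: thin_tame.
- by move=> r tr; exact: commg_commute_conj.
Qed.

Lemma commg_right_commute : commute [~ g, b] a.
Proof.
have q12 : commute q2^-1 q1.
  apply: commuteVl; apply: commute_sym; rewrite /q1; apply: commuteR.
    apply: commuteR; apply: commute_sym; first exact: q2a.
    by have [] := commg3_commute Sb Sz Sa.
  exact: commute_sym.
have h0b : commute ([~ q1, w] ^ q2^-1) b.
  apply/commuteJl; rewrite invgK commute_conj; last exact: commute_sym.
  exact: commg_commg_commute.
have -> : [~ g, b] = [~ q2^-1, w, b].
  rewrite /g (jacobi_commg Sa Sb Sz) -/q1 -/q2 q12 (commgMl q1) (commgMl ([~ q1, w] ^ q2^-1)).
  by move/commgP/eqP: h0b => ->; rewrite conj1g mul1g.
apply: double_commg_commute => //.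
- by apply: thin_commgV => //; exact: thin_tame.
- exact: commuteVl.
- by move=> r tr; apply/commuteVl/commg_commute_conj.
- exact: commuteVl.
Qed.

End Commutator.

(** As [[~ a, b] = a^-1 * a ^ b], with commuting factors, it suffices that [a] and
[a ^ b] act alike on [g = [~ a, b, z, w]]. Conjugating [g] by [b^-1], [a] and [b]
in turn only multiplies it by [[~ g, a]] and by powers of [[~ g, b]], and these
powers cancel because [[~ g, b]] commutes with [a], [b] and [[~ g, a]]. *)
Lemma commg4_commute a b z w : S a -> S b -> S z -> S w ->
  commute [~ a, b, z, w] [~ a, b].
Proof.
move=> Sa Sb Sz Sw; set c := [~ a, b]; set p := [~ c, z]; set g := [~ p, w].
have [pa pb pz] := commg3_commute Sa Sb Sz.
have ka_b : commute [~ g, a] b by exact: commg_left_commute.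
have kb_a : commute [~ g, b] a by exact: commg_right_commute.
have tg : tame S g.
  by do 2![apply/thin_tame/thin_commg => //]; exact: tame_commg_mem.
have kb_b : commute [~ g, b] b by exact: commg_commuter.
(* apply the previous lemma to [~ b, a, z, w], which is g^-1 up to conjugation *)
have kb_ag : commute [~ g, b] (a ^ g).
  have := commg_left_commute Sb Sa Sz Sw.
  have pc : commute p^-1 c^-1.
    by apply/commuteVl/commuteV/commute_sym/commuteR; exact: commute_sym.
  have -> : [~ b, a, z, w] = (g^-1) ^ p^-1.
    have -> : [~ b, a, z] = p^-1.
      by rewrite -invgR -/c -[RHS](commute_conj pc) /p; group_id.
    by rewrite (commgVl p w).
  have -> : [~ (g^-1) ^ p^-1, b] = [~ g^-1, b] ^ p^-1.
    by rewrite conjRg (commute_conj (commute_sym (commuteVl pb))).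
  rewrite (commgVl g b).
  move=> /(@commuteJ _ _ _ p); rewrite conjgKV (commute_conj (commute_sym pa)).
  by move=> /(@commuteJ _ _ _ g); rewrite conjgKV => /commuteVl; rewrite invgK.
have ka_kb : commute [~ g, a] [~ g, b].
  rewrite commgE2; apply: commute_divl; exact: commute_sym.
have Eb : g ^ b^-1 = g * [~ g, b]^-1.
  apply: (@conjg_inj _ b); rewrite conjgKV conjMg conjVg (commute_conj kb_b).
  by rewrite (conjg_mulR g b) mulgK.
have Ea : g ^ (a ^ b) = g ^ a.
  rewrite [a ^ b]conjgE conjgM conjgM Eb (conjMg g) (conjVg _ a).
  rewrite (commute_conj kb_a) (conjMg (g ^ a)) (conjVg _ b) (commute_conj kb_b).
  rewrite (conjg_mulR g a) (conjMg g) (commute_conj ka_b) (conjg_mulR g b).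
  by rewrite -(mulgA g) -ka_kb mulgA mulgK.
rewrite /c commgEl; apply: conj_commute.
have aab : commute a (a ^ b) by exact: S1.
by rewrite (commuteVl aab) conjgM Ea conjgK.
Qed.

Lemma commg_commute_conj1 a b z : S a -> S b -> S z ->
  commute [~ a, b] ([~ a, b] ^ z).
Proof.
move=> Sa Sb Sz; have [pa pb _] := commg3_commute Sa Sb Sz.
rewrite (conjg_mulR [~ a, b]); apply: commuteM; first exact: commute_refl.
by apply: commuteR; exact: commute_sym.
Qed.

Lemma commg_commute_conj2 a b z v : S a -> S b -> S z -> S v ->
  commute ([~ a, b] ^ z) ([~ a, b] ^ v).
Proof.
move=> Sa Sb Sz Sv; have [pa pb _] := commg3_commute Sa Sb Sz.
rewrite (conjg_mulR [~ a, b] z); apply: commuteMl.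
  exact: commg_commute_conj1.
apply: commuteJV; rewrite (conjg_mulR [~ a, b, z]); apply: commuteMl.
  by apply/commute_sym/commuteR; exact: commute_sym.
by apply: commg4_commute => //; exact: SV.
Qed.

(** What [x ^ y] looks like when [x] and [y] are members or commutators of
members: the thin shape, except when [y] is itself in [S]. *)
Definition spread x y :=
  S y \/ exists u v, [/\ S u, S v & x ^ y = x ^ u * x^-1 * x ^ v].

Lemma spread_commute x y z : (forall u, S u -> commute x (x ^ u)) ->
    (forall u v, S u -> S v -> commute (x ^ u) (x ^ v)) ->
  spread x y -> spread x z -> commute x (x ^ y) /\ commute (x ^ y) (x ^ z).
Proof.
move=> x1 x2.
have aux t : commute t x -> (forall u, S u -> commute t (x ^ u)) ->
    forall y, spread x y -> commute t (x ^ y).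
  move=> tx txu y' [Sy|[u [v [Su Sv ->]]]]; first exact: txu.
  apply: commuteM; last exact: txu.
  by apply: commuteM; [exact: txu | exact: commuteV].
move=> xy xz; have xxy : forall y, spread x y -> commute x (x ^ y).
  by apply: (aux) => //; exact: commute_refl.
split; first exact: xxy.
apply: (aux _ _ _ _ xz) => [|u Su]; first exact/commute_sym/xxy.
by apply/commute_sym; apply: (aux _ _ _ _ xy) => [|v Sv]; [exact/commute_sym/x1|exact: x2].
Qed.

Definition add_commutators : set G :=
  [set x | S x \/ exists a b, [/\ S a, S b & x = [~ a, b]]].

(** Conjugation by a member of the enlarged set has the shape [spread] on the
whole enlarged set, so only conjugates by elements of [S] remain to be compared;
for a commutator this is [commg3_commute] and [commg4_commute]. *)
Lemma strong_add_commutators : strong_set add_commutators.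
Proof.
have thin_add y : add_commutators y -> forall x, add_commutators x -> spread x y.
  move=> [Sy|[a [b [Sa Sb ->]]]] x Tx; first by left.
  right; case: Tx => [Sx|[c [d [Sc Sd ->]]]]; first exact: thin_commg_mem.
  exists a^-1, (a ^ b); split; [exact: SV|exact: SJ|].
  rewrite (commgEl a b); apply: conj_div; first exact: S1.
  apply: commuteJV; rewrite invgR.
  by have [_] := tame_commg_mem Sd Sc Sa; apply.
have comm_add x y z : add_commutators x -> add_commutators y ->
    add_commutators z -> commute x (x ^ y) /\ commute (x ^ y) (x ^ z).
  move=> Tx Ty Tz; apply: spread_commute; try exact: thin_add.
  - move=> u Su; case: Tx => [Sx|[c [d [Sc Sd ->]]]]; first exact: S1.
    exact: commg_commute_conj1.
  - move=> u v Su Sv; case: Tx => [Sx|[c [d [Sc Sd ->]]]]; first exact: S2.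
    exact: commg_commute_conj2.
split.
- move=> x g [Sx|[a [b [Sa Sb ->]]]]; first by left; exact: SJ.
  by right; exists (a ^ g), (b ^ g); rewrite conjRg; split=> //; exact: SJ.
- move=> x [Sx|[a [b [Sa Sb ->]]]]; first by left; exact: SV.
  by right; exists b, a; rewrite invgR.
- by move=> x y Tx Ty; have [] := comm_add x y y Tx Ty Ty.
- by move=> x y z Tx Ty Tz; have [] := comm_add x y z Tx Ty Tz.
Qed.

End StrongSet.

(** * The closure of a strong set under commutators *)

Section CommutatorClosure.
Variables (G : groupType) (S : set G).
Hypothesis sS : strong_set S.

Definition commutator_closure : set G :=
  [set x | exists n, iter n (@add_commutators G) S x].

Let iter_strong n : strong_set (iter n (@add_commutators G) S).
Proof. by elim: n => //= n IH; exact: strong_add_commutators. Qed.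

Let iter_mono m n x : m <= n -> iter m (@add_commutators G) S x ->
  iter n (@add_commutators G) S x.
Proof.
move=> /subnK <-; elim: (n - m) => //= k IH Sx.
by left; exact: IH.
Qed.

Lemma sub_commutator_closure : S `<=` commutator_closure.
Proof. by move=> x Sx; exists 0. Qed.

Lemma commutator_closure_commg x y :
  commutator_closure x -> commutator_closure y -> commutator_closure [~ x, y].
Proof.
move=> [m Tx] [n Ty]; exists (maxn m n).+1; right; exists x, y; split=> //.
  exact: iter_mono (leq_maxl _ _) Tx.
exact: iter_mono (leq_maxr _ _) Ty.
Qed.

Lemma strong_commutator_closure : strong_set commutator_closure.
Proof.
split.
- by move=> x g [n Sx]; exists n; have [+ _ _ _] := iter_strong n; apply.
- by move=> x [n Sx]; exists n; have [_ + _ _] := iter_strong n; apply.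
- move=> x y [m Tx] [n Ty]; have [_ _ + _] := iter_strong (maxn m n); apply.
    exact: iter_mono (leq_maxl _ _) Tx.
  exact: iter_mono (leq_maxr _ _) Ty.
- move=> x y z [m Tx] [n Ty] [k Tz].
  have [_ _ _] := iter_strong (maxn (maxn m n) k); apply.
  + by apply: iter_mono Tx; rewrite -maxnA leq_maxl.
  + by apply: iter_mono Ty; rewrite (leq_trans (leq_maxr m n))// leq_maxl.
  + by apply: iter_mono Tz; exact: leq_maxr.
Qed.

End CommutatorClosure.

(** * Words and the order of the first difference *)

Section Words.
Local Open Scope nat_scope.
Variable n : nat.
Local Notation word := (seq 'I_n).
Implicit Types (u v w p q r s t b : word) (x y e : 'I_n) (L D : set word).

(** Compares two words at the first place where they differ; a word and its
prefixes are incomparable. Unlike the lexicographic order, this order survives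
arbitrary prolongations of both words ([split_lt_catr]). *)
Fixpoint split_lt u v : bool :=
  match u, v with
  | x :: u', y :: v' => (x < y) || (x == y) && split_lt u' v'
  | _, _ => false
  end.

(** The lexicographic order. *)
Definition dict_le u v := prefix u v || split_lt u v.

Lemma split_lt_cat2l p u v : split_lt (p ++ u) (p ++ v) = split_lt u v.
Proof. by elim: p => //= x p ->; rewrite ltnn eqxx. Qed.

Lemma split_lt_catr u v p q : split_lt u v -> split_lt (u ++ p) (v ++ q).
Proof.
elim: u v => [|x u IH] [|y v] //= /orP[->//|/andP[-> /IH ->]].
by rewrite orbT.
Qed.

Lemma split_lt_trans u v w : split_lt u v -> split_lt v w -> split_lt u w.
Proof.
elim: u v w => [|x u IH] [|y v] [|z w] //=.
move=> /orP[xy|/andP[/eqP-> uv]] /orP[yz|/andP[/eqP<- vw]].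
- by rewrite (ltn_trans xy yz).
- by rewrite xy.
- by rewrite yz.
- by rewrite eqxx (IH _ _ uv vw) orbT.
Qed.

Lemma split_lt_irr u : split_lt u u = false.
Proof. by elim: u => //= x u ->; rewrite ltnn andbF. Qed.

Lemma split_lt_prefix u v : prefix u v -> split_lt v u = false.
Proof.
move=> /prefixP[w ->]; rewrite -[X in split_lt _ X]cats0 split_lt_cat2l.
by case: w.
Qed.

Lemma split_ltVprefix u v :
  [\/ split_lt u v, split_lt v u, prefix u v | prefix v u].
Proof.
elim: u v => [|x u IH] [|y v] /=; try by [apply: Or43|apply: Or44].
case: (ltngtP x y) => [xy|yx|/val_inj <-]; [exact: Or41|exact: Or42|].
rewrite ?eqxx /=; exact: IH.
Qed.

Lemma dict_le_trans u v w : dict_le u v -> dict_le v w -> dict_le u w.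
Proof.
move=> /orP[/prefixP[p ->]|uv] /orP[/prefixP[q ->]|vw].
- by rewrite /dict_le -catA prefix_prefix.
- case: (split_ltVprefix u w) => [h|h|h|h]; rewrite /dict_le ?h ?orbT //.
  + have := split_lt_catr [::] p h; rewrite cats0 => /(split_lt_trans vw).
    by rewrite split_lt_irr.
  + by rewrite split_lt_prefix // in vw; exact: prefix_trans h (prefix_prefix _ _).
- by rewrite /dict_le -[u]cats0 (split_lt_catr _ _ uv) orbT.
- by rewrite /dict_le (split_lt_trans uv vw) orbT.
Qed.

(** This is the usual notion, with the lexicographic order: a word that is smaller
than its proper suffix [q] cannot have [q] as a prefix, and is too long to be
one of [q], so the two words do differ at some place. *)
Definition lyndon u := u <> [::] /\
  forall p q, u = p ++ q -> p <> [::] -> q <> [::] -> split_lt u q.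

Lemma least_suffix w : w <> [::] -> exists p v, [/\ w = p ++ v, v <> [::] &
  forall p' v', w = p' ++ v' -> v' <> [::] -> dict_le v v'].
Proof.
elim: w => // x w IH _; have [->|/eqP w0] := eqVneq w [::].
  exists [::], [:: x]; split=> // -[|y p] [|z v] //=.
    by move=> [-> ->] _; rewrite /dict_le prefix_refl.
  by case=> _; case: p.
have [p [v [wE v0 vmin]]] := IH w0.
have [h|h|h|h] := split_ltVprefix v (x :: w).
- exists (x :: p), v; rewrite wE; split=> // -[|y p'] v' /=.
    by move=> <- _; rewrite -wE /dict_le h orbT.
  by case=> _; rewrite -wE; exact: vmin.
- exists [::], (x :: w); split=> // -[|y p'] v' /=.
    by move=> <- _; rewrite /dict_le prefix_refl.
  case=> _ /vmin vv' /vv'; apply: dict_le_trans.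
  by rewrite /dict_le h orbT.
- exists (x :: p), v; rewrite wE; split=> // -[|y p'] v' /=.
    by move=> <- _; rewrite -wE /dict_le h.
  by case=> _; rewrite -wE; exact: vmin.
- by move/size_prefix: h; rewrite wE /= size_cat ltnNge leq_addl.
Qed.

(** The standard factorization: [v] is the lexicographically least proper suffix.
It is Lyndon by minimality. If [p] were not below one of its proper suffixes [q],
then either [q ++ v] would be below [u], or [p = q ++ r] and the proper suffix
[r ++ v] of [u] would be below [v]. *)
Lemma lyndon_factor u : lyndon u -> 1 < size u ->
  exists p v, [/\ u = p ++ v, lyndon p & lyndon v].
Proof.
case: u => [|x w] // [_ lu] w1.
have w0 : w <> [::] by case: w w1 {lu}.
have [p [v [wE v0 vmin]]] := least_suffix w0.
exists (x :: p), v; split; first by rewrite wE.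
- split=> // p1 q PE p10 q0.
  have luv : split_lt (x :: w) (q ++ v).
    apply: (lu p1) => //; first by rewrite wE -cat_cons PE catA.
    by case: q q0 {PE}.
  have [//|h|h|h] := split_ltVprefix (x :: p) q.
  + have := split_lt_trans luv (split_lt_catr v v h).
    by rewrite wE -cat_cons split_lt_irr.
  + move/size_prefix: h; rewrite PE size_cat leqNgt.
    by rewrite -[X in X < _]add0n ltn_add2r; case: p1 p10 {PE}.
  + have /prefixP[p2 PE2] := h.
    move: luv; rewrite wE -cat_cons PE2 -catA split_lt_cat2l => lt2.
    have : dict_le v (p2 ++ v).
      case: q q0 PE2 {PE h} => // y q _ [_ PE2].
      by apply: (vmin q); [rewrite wE PE2 catA | case: p2 {lt2 PE2}].
    case/orP => [/split_lt_prefix|h2]; first by rewrite lt2.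
    by have := split_lt_trans h2 lt2; rewrite split_lt_irr.
- split=> // p1 q vE p10 q0.
  have /orP[h|//] : dict_le v q by apply: (vmin (p ++ p1)) => //; rewrite wE vE catA.
  move/size_prefix: h; rewrite vE size_cat leqNgt.
  by rewrite -[X in X < _]add0n ltn_add2r; case: p1 p10 {vE}.
Qed.

(** * Unavoidable patterns in factor-closed languages *)

Definition language L := [/\ L [::], forall v w, infix v w -> L w -> L v &
  forall w, L w -> exists x, L (rcons w x)].

(** Known as uniform recurrence. *)
Definition recurrent L :=
  forall w, L w -> exists k, forall v, L v -> size v = k -> infix w v.

(** By Zorn, some sublanguage is minimal; the maximal element below is the set of
words removed. An upper bound of a chain stays a language because only finitely
many letters compete to prolong a word. In a minimal language [L], if a word [w]
were missing from arbitrarily long words, then the words that can be prolonged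
by any length while avoiding [w] would form a smaller language. *)
Lemma recurrent_sublanguage L0 : language L0 ->
  exists2 L, L `<=` L0 & language L /\ recurrent L.
Proof.
move=> gL0.
have [F FP totF|D [gD maxD]] := @Zorn_bigcup _ [set D | language (L0 `\` D)].
  split.
  - split; first by case: gL0.
    by move=> [D FD Dnil]; have [[]] := FP D FD.
  - move=> v w vw [L0w nFw]; split; first by case: gL0 => _ + _; apply; first exact: vw.
    move=> [D FD Dv]; have [_ fD _] := FP D FD.
    have [] := fD v w vw; last by [].
    by split=> // Dw; apply: nFw; exists D.
  - move=> w [L0w nFw].
    have [D DF Dx] : exists2 D, F D \/ D = set0 & forall x, x \in enum 'I_n ->
        (exists2 D', F D' & D' (rcons w x)) -> D (rcons w x).
      elim: (enum 'I_n) => [|x s [D DF IH]]; first by exists set0 => //; right.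
      have [[D' FD' D'x]|nx] := pselect (exists2 D', F D' & D' (rcons w x)); last first.
        by exists D => // y; rewrite inE => /orP[/eqP->|/IH].
      case: DF => [FD|D0].
        have [DD'|D'D] := totF _ _ FD FD'.
          exists D'; first by left.
          by move=> y; rewrite inE => /orP[/eqP->|/IH h /h /DD'].
        exists D; first by left.
        move=> y; rewrite inE => /orP[/eqP-> _|/IH h /h //]; exact: D'D.
      exists D'; first by left.
      by move=> y; rewrite inE => /orP[/eqP->//|/IH h /h]; rewrite D0.
    have [_ _ eD] : language (L0 `\` D).
      by case: DF => [/FP//|->]; rewrite setD0.
    have [x [L0x nDx]] : exists x, (L0 `\` D) (rcons w x).
      apply: eD; split=> // Dw; case: DF => [FD|D0]; last by rewrite D0 in Dw.
      by apply: nFw; exists D.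
    exists x; split=> // -[D' FD' D'x]; apply: nDx; apply: Dx.
      by rewrite mem_enum.
    by exists D'.
exists (L0 `\` D); first by move=> x [].
split=> // w Lw; apply: contrapT => nw.
have {}nw k : exists2 v, (L0 `\` D) v & size v = k /\ ~~ infix w v.
  apply: contrapT => h; apply: nw; exists k => v Lv sv.
  by apply: contraT => nwv; exfalso; apply: h; exists v.
set L := L0 `\` D in gD nw Lw.
have [Lnil Lf Le] := gD.
pose good v k := exists2 t, size t = k & L (v ++ t) /\ ~~ infix w (v ++ t).
pose D' := D `|` [set v | ~ forall k, good v k].
apply: (maxD D').
  split; first by move=> v; left.
  move=> /(_ w) h; have [_ nDw] := Lw; apply: nDw; apply: h; right => /(_ 0) [t _ [_]].
  by rewrite prefix_infix.
have E v : (L0 `\` D') v <-> forall k, good v k.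
  split=> [[L0v nD'v] k|gv].
    have : ~ ~ forall k, good v k by move=> h; apply: nD'v; right.
    by move=> /contrapT; apply.
  have [t /size0nil -> []] := gv 0; rewrite cats0 => -[L0v nDv] _.
  by split=> // -[|].
split.
- by apply/E => k; have [v Lv [sv nwv]] := nw k; exists v.
- move=> v w' /infixP[p [q ->]] /E gw'; apply/E => k.
  have [t st [Lt nt]] := gw' k.
  have vi : infix (v ++ take k (q ++ t)) ((p ++ v ++ q) ++ t).
    apply/infixP; exists p, (drop k (q ++ t)).
    by rewrite -!catA cat_take_drop.
  exists (take k (q ++ t)).
    by rewrite size_takel // size_cat st leq_addl.
  split; first exact: Lf Lt.
  by apply: contra nt => wi; exact: infix_trans vi.
- move=> v /E gv; apply: contrapT => nx.
  have {}nx x : exists k, ~ good (rcons v x) k.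
    by apply/existsNP => h; apply: nx; exists x; apply/E.
  have [f fP] := choice nx.
  have [[|x t] // [st] [Lt nt]] := gv (\max_(x < n) f x).+1.
  apply: (fP x); exists (take (f x) t).
    by rewrite size_takel // st leq_bigmax.
  have vi : infix (rcons v x ++ take (f x) t) (v ++ x :: t).
    apply/infixP; exists [::], (drop (f x) t).
    by rewrite cat0s -catA cat_take_drop cat_rcons.
  split; first exact: Lf Lt.
  by apply: contra nt => wi; exact: infix_trans vi.
Qed.



Section LeastWord.
Variable L : set word.
Hypotheses (gL : language L) (rL : recurrent L).

Let Lnil : L [::]. Proof. by case: gL. Qed.
Let Lfactor p v q : L (p ++ v ++ q) -> L v.
Proof. by case: gL => _ + _; apply; apply/infixP; exists p, q. Qed.

Lemma least_extension : exists nx : word -> 'I_n, forall w, L w ->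
  L (rcons w (nx w)) /\ forall x, L (rcons w x) -> nx w <= x.
Proof.
case: gL => _ _ eL; have [x0 _] := eL _ Lnil.
suff /choice[f fP] : forall w, exists x, L w ->
  L (rcons w x) /\ forall y, L (rcons w y) -> x <= y by exists f.
move=> w; have [Lw|nLw] := pselect (L w); last by exists x0.
have [x Lx] := eL w Lw; have /asboolP/= Px := Lx.
exists [arg min_(y < x | `[< L (rcons w y) >]) (y : nat)] => _.
case: arg_minnP => // y /asboolP Ly ymin; split=> // z Lz.
by apply: ymin; apply/asboolP.
Qed.

(** The prefix of length [k] of the infinite word formed by always appending the
least letter possible. *)
Definition least_word (nx : word -> 'I_n) k := iter k (fun w => rcons w (nx w)) [::].

Variable nx : word -> 'I_n.
Hypothesis nxP : forall w, L w ->
  L (rcons w (nx w)) /\ forall x, L (rcons w x) -> nx w <= x.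

Local Notation M := (least_word nx).

Lemma least_word_in k : L (M k).
Proof. by elim: k => //= k /nxP[]. Qed.

Lemma size_least_word k : size (M k) = k.
Proof. by elim: k => //= k IH; rewrite size_rcons IH. Qed.

Lemma least_word_prefix k l : k <= l -> exists q, M l = M k ++ q.
Proof.
move=> /subnK <-; elim: (l - k) => [|m [q IH]] /=; first by exists [::]; rewrite cats0.
by exists (rcons q (nx (M (m + k)))); rewrite -rcons_cat -IH.
Qed.

Lemma take_least_word k l : k <= l -> take k (M l) = M k.
Proof.
by move=> /least_word_prefix[q ->]; rewrite take_size_cat // size_least_word.
Qed.

Lemma least_wordP v : L v -> v = M (size v) \/ split_lt (M (size v)) v.
Proof.
elim/last_ind: v => [|v x IH] Lx; first by left.
have Lv : L v by apply: (@Lfactor [::] v [:: x]); rewrite cats1.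
rewrite size_rcons /=; have [vE|lt] := IH Lv.
  rewrite -vE; have [_ /(_ x Lx)] := nxP Lv.
  rewrite leq_eqVlt => /orP[/eqP/val_inj->|lt]; [by left|right].
  by rewrite -!cats1 split_lt_cat2l /= lt.
by right; rewrite -!cats1; exact: split_lt_catr.
Qed.

Definition bordered w := exists i, [/\ 0 < i, i < size w &
  drop i w = take (size w - i) w].

(** Any proper suffix is at least the prefix of the same length, since that is the
least word of its length; without borders the two are distinct. *)
Lemma unbordered_lyndon k : 0 < k -> ~ bordered (M k) -> lyndon (M k).
Proof.
move=> k0 nb; split; first by move=> E; rewrite -(size_least_word k) E in k0.
move=> p q E p0 q0.
have sE : size p + size q = k by rewrite -size_cat -E size_least_word.
have sp : 0 < size p by case: p p0 {E sE}.
have sq : 0 < size q by case: q q0 {E sE}.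
have Lq : L q by apply: (@Lfactor p q [::]); rewrite cats0 -E; exact: least_word_in.
have qk : size q <= k by rewrite -sE leq_addl.
have [qE|lt] := least_wordP Lq.
  case: nb; exists (size p); rewrite size_least_word -sE addKn sE.
  by rewrite take_least_word // E drop_size_cat // -qE; split;
    rewrite // -sE -[X in X < _]addn0 ltn_add2l.
have [r ->] := least_word_prefix qk.
by rewrite -[q]cats0 split_lt_catr // cats0.
Qed.

(** [s] is the first return time of [M l] in the infinite word: uniform recurrence
makes [M l] occur again, after the first letter of a long enough prefix. *)
Lemma least_word_return l : exists s : nat, [/\ 0 < s, drop s (M (s + l)) = M l &
  forall i, 0 < i -> i < s -> drop i (M (i + l)) <> M l].
Proof.
have [|s /andP[s0 /eqP sE] smin] :=
    @ex_minnP (fun s : nat => (0 < s) && (drop s (M (s + l)) == M l)).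
  have [k kP] := rL (least_word_in l).
  have sk : size (drop 1 (M k.+1)) = k by rewrite size_drop size_least_word subn1.
  have Lk : L (drop 1 (M k.+1)).
    apply: (@Lfactor (take 1 (M k.+1)) _ [::]); rewrite cats0 cat_take_drop.
    exact: least_word_in.
  have /infixP[p [q E]] := kP _ Lk sk.
  have [x ME] : exists x, M k.+1 = x :: p ++ M l ++ q.
    move: E (size_least_word k.+1); case: (M k.+1) => //= x w; rewrite drop0.
    by move=> -> _; exists x.
  have lk : (size p).+1 + l <= k.+1.
    have := size_least_word k.+1; rewrite ME /= !size_cat size_least_word.
    by move=> [<-]; rewrite addnA ltnS leq_addr.
  exists (size p).+1; rewrite -(take_least_word lk) ME addSn /= catA.
  by rewrite take_size_cat ?size_cat ?size_least_word // drop_size_cat.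
exists s; split=> // i i0 lt /eqP iE.
by have := smin i; rewrite i0 iE leqNgt lt => /(_ isT).
Qed.

(** Write [M s = rcons u e] for the first return time [s] of [M l]. If [u] is
empty, then [M l] starts with [e], which gives [e e]. If [u] has a border, its
shortest border [b] is unbordered, hence Lyndon, and at most [l] long, since
otherwise [M l] would return earlier; so [u ++ e :: M l] contains [b e b].
Otherwise [u] is itself Lyndon. *)
Lemma return_pattern l : 0 < l ->
  [\/ exists e, L [:: e; e],
      exists b e, lyndon b /\ L (b ++ e :: b) |
      exists u e, [/\ lyndon u, L (e :: M l) & M (size u).+1 = rcons u e]].
Proof.
move=> l0; have [[|s] [//_ sE smin]] := least_word_return l.
set u := M s; set e := nx u.
have su : size u = s by exact: size_least_word.
have ME : M (s.+1 + l) = u ++ e :: M l.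
  have [q E] := least_word_prefix (leq_addr l s.+1).
  move: sE; rewrite E drop_size_cat ?size_least_word // => ->.
  by rewrite -cat_rcons.
have Ls : L (u ++ e :: M l) by rewrite -ME; exact: least_word_in.
have Le : L (e :: M l) by apply: (@Lfactor u _ [::]); rewrite cats0.
have [s0|s0] := posnP s.
  apply: Or31; exists e; have [q E] := least_word_prefix l0.
  by apply: (@Lfactor [::] _ q); move: Le; rewrite E /e /u s0.
have [bu|nbu] := pselect (bordered u); last first.
  apply: Or33; exists u, e; split=> //; first exact: unbordered_lyndon.
  by rewrite su.
apply: Or32.
pose P i := [&& 0 < i, i < s & drop i u == M (s - i)].
have exP : exists i, P i.
  have [i []] := bu; rewrite su => i0 il iE; exists i; rewrite /P i0 il iE.
  by rewrite take_least_word ?eqxx // leq_subr.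
have ubP i : P i -> i <= s by case/and3P => _ /ltnW.
(* the largest period i of u corresponds to its shortest border *)
have [i /and3P[i0 il /eqP bE] imax] := ex_maxnP exP ubP.
exists (M (s - i)), e; split.
  apply: unbordered_lyndon; first by rewrite subn_gt0.
  move=> [j []]; rewrite size_least_word => j0 jl jE.
  have ijs : i + j < s by rewrite -ltn_subRL.
  have ijE : drop (i + j) u = M (s - (i + j)).
    by rewrite addnC -drop_drop bE jE take_least_word ?leq_subr // addnC subnDA.
  have := imax (i + j); rewrite /P addn_gt0 i0 ijs ijE eqxx => /(_ isT).
  by rewrite -[X in _ <= X]addn0 leq_add2l leqNgt j0.
have bl : s - i <= l.
  rewrite leqNgt; apply/negP => lb.
  apply: (smin i i0 (ltnW il)).
  have il_s : i + l <= s by rewrite -leq_subRL ltnW.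
  rewrite -(take_least_word il_s) addnC -take_drop bE.
  by apply: take_least_word; exact: ltnW.
have [q E] := least_word_prefix bl.
apply: (@Lfactor (take i u) _ q).
by rewrite -catA /= -E -bE catA cat_take_drop.
Qed.

End LeastWord.

(** In the remaining case of [return_pattern], two lengths [l] share the same
letter [e] by the pigeonhole principle. Taking them far enough apart, [M l] for
the larger one begins with [rcons u e], where [u] belongs to the smaller one, so
that [e :: M l] contains [e u e]. *)
Theorem unavoidable_pattern L : language L ->
  [\/ exists e, L [:: e; e],
      exists b e, lyndon b /\ L (b ++ e :: b) |
      exists u e, lyndon u /\ L (e :: rcons u e)].
Proof.
move=> /recurrent_sublanguage[L' L'L [gL' rL']].
suff [[e h]|[b [e [lb h]]]|[u [e [lu h]]]] :
    [\/ exists e, L' [:: e; e], exists b e, lyndon b /\ L' (b ++ e :: b) |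
        exists u e, lyndon u /\ L' (e :: rcons u e)].
- by apply: Or31; exists e; exact: L'L.
- by apply: Or32; exists b, e; split=> //; exact: L'L.
- by apply: Or33; exists u, e; split=> //; exact: L'L.
apply: contrapT => none.
have [nx nxP] := least_extension gL'.
have /choice[f fP] : forall l, exists ue : word * 'I_n, 0 < l ->
    [/\ lyndon ue.1, L' (ue.2 :: least_word nx l) &
        least_word nx (size ue.1).+1 = rcons ue.1 ue.2].
  case=> [|l]; first by exists ([::], nx [::]).
  have [h|h|[u [e h]]] := return_pattern gL' rL' nxP (ltn0Sn l).
  - by case: none; apply: Or31.
  - by case: none; apply: Or32.
  - by exists (u, e).
(* lengths such that each exceeds the return times for the preceding ones *)
pose t := fix t k := if k is k'.+1 then t k' + (size (f (t k')).1).+1 else 1.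
have t0 k : 0 < t k by case: k => //= k; rewrite addnS.
have tmono i j : i <= j -> t i <= t j.
  by move=> /subnK <-; elim: (j - i) => //= k /leq_trans; apply; exact: leq_addr.
have /injectivePn[i [j ij /= eij]] : ~~ injectiveb (fun i : 'I_n.+1 => (f (t i)).2).
  apply/injectiveP => /leq_card; by rewrite !card_ord ltnn.
wlog {ij} ij : i j eij / i < j.
  move=> h; move: ij; rewrite neq_ltn => /orP[/h|/h]; apply; by rewrite ?eij.
have [lu _ uE] := fP _ (t0 i); have [_ Le _] := fP _ (t0 j).
case: none; apply: Or33; exists (f (t i)).1, (f (t i)).2; split=> //.
have le : (size (f (t i)).1).+1 <= t j.
  by rewrite (leq_trans _ (tmono _ _ ij)) //= leq_addl.
have [q E] := least_word_prefix nx le.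
case: gL' => _ + _; apply; last exact: Le.
by rewrite E uE eij -cat_cons prefixW // prefix_prefix.
Qed.

End Words.

(** * Generated subgroups and lower central series *)

Section Subgroups.
Variable G : groupType.
Implicit Types (A S H K U : set G) (x y g : G).

Lemma subgroupR H x y : is_subgroup H -> H x -> H y -> H [~ x, y].
Proof.
move=> [_ HM HV] Hx Hy; rewrite commgEl conjgE.
by apply: (HM); [exact: HV | apply: (HM); [exact: HV | exact: HM]].
Qed.

Lemma subgroupJ H x y : is_subgroup H -> H x -> H y -> H (x ^ y).
Proof.
by move=> sH Hx Hy; rewrite conjg_mulR; case: (sH) => _ + _; apply => //; exact: subgroupR.
Qed.

Lemma subgroup_gen_subgroup A : is_subgroup (subgroup_gen A).
Proof.
split.
- by move=> H [[]].
- by move=> x y Ax Ay H HA; have [[_ HM _] _] := HA; exact: HM (Ax _ HA) (Ay _ HA).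
- by move=> x Ax H HA; have [[_ _ HV] _] := HA; exact: HV (Ax _ HA).
Qed.

Lemma mem_subgroup_gen A x : A x -> subgroup_gen A x.
Proof. exact: sub_gen_smallest. Qed.

Lemma subgroup_gen_sub A H : is_subgroup H -> A `<=` H -> subgroup_gen A `<=` H.
Proof. exact: smallest_sub. Qed.

Lemma subgroup_genS A S : A `<=` S -> subgroup_gen A `<=` subgroup_gen S.
Proof.
move=> AS; apply: subgroup_gen_sub; first exact: subgroup_gen_subgroup.
by move=> x /AS; exact: mem_subgroup_gen.
Qed.

Lemma lower_central_commg H m x y :
  lower_central H m x -> H y -> lower_central H m.+1 [~ x, y].
Proof. by move=> Lx Hy; apply: mem_subgroup_gen; exists x => //; exists y. Qed.

Lemma lower_centralS H K m : H `<=` K -> lower_central H m `<=` lower_central K m.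
Proof.
move=> HK; elim: m => //= m IH; apply: subgroup_genS => _ [x Lx [y Hy <-]].
by exists x; [exact: IH | exists y; [exact: HK|]].
Qed.

Lemma lower_central1 H m : is_subgroup H -> lower_central H m 1.
Proof. by case: m => [|m] sH; [case: sH | case: (subgroup_gen_subgroup
  [set [~ x, y] | x in lower_central H m & y in H])]. Qed.

Lemma is_nilpotentS H K : is_subgroup H -> H `<=` K -> is_nilpotent K -> is_nilpotent H.
Proof.
move=> sH HK [c Kc]; exists c; apply/seteqP; split=> [x Hx|x ->].
  by have := lower_centralS HK Hx; rewrite (Kc : _ = _).
exact: lower_central1.
Qed.

Lemma subgroup_gen_finite S x : subgroup_gen S x ->
  exists q : seq G, (forall y, y \in q -> S y) /\ subgroup_gen [set` q] x.
Proof.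
apply: (subgroup_gen_sub (H := [set x | exists q : seq G,
  (forall y, y \in q -> S y) /\ subgroup_gen [set` q] x])) => [|y Sy]; last first.
  exists [:: y]; split=> [z|]; first by rewrite inE => /eqP ->.
  by apply: mem_subgroup_gen; rewrite /= inE.
split.
- by exists [::]; split=> //; have [] := subgroup_gen_subgroup [set` [::]].
- move=> y z [q [qS qy]] [r [rS rz]]; exists (q ++ r); split.
    by move=> w; rewrite mem_cat => /orP[/qS|/rS].
  have [_ + _] := subgroup_gen_subgroup [set` q ++ r]; apply.
    by apply: (@subgroup_genS [set` q]) qy => w /= wq; rewrite mem_cat wq.
  by apply: (@subgroup_genS [set` r]) rz => w /= wr; rewrite mem_cat wr orbT.
- move=> y [q [qS qy]]; exists q; split=> //.
  by have [_ _] := subgroup_gen_subgroup [set` q]; apply.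
Qed.

Lemma subgroup_gen_finite_seq S (p : seq G) : (forall x, x \in p -> subgroup_gen S x) ->
  exists q : seq G, (forall y, y \in q -> S y) /\
    forall x, x \in p -> subgroup_gen [set` q] x.
Proof.
elim: p => [|x p IH] h; first by exists [::].
have [q [qS qp]] := IH (fun y yp => h y (mem_behead (s := x :: p) yp)).
have [r [rS rx]] := subgroup_gen_finite (h x (mem_head x p)).
exists (r ++ q); split=> [y|y].
  by rewrite mem_cat => /orP[/rS|/qS].
rewrite inE => /orP[/eqP->|/qp].
  by apply: (subgroup_genS _ rx) => w /= wr; rewrite mem_cat wr.
by apply: subgroup_genS => w /= wr; rewrite mem_cat wr orbT.
Qed.

Lemma subgroup_gen_conj S g : (forall x, S x -> S (x ^ g)) ->
  forall x, subgroup_gen S x -> subgroup_gen S (x ^ g).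
Proof.
move=> SJ; have [s1 sM sV] := subgroup_gen_subgroup S.
apply: (subgroup_gen_sub (H := [set x | subgroup_gen S (x ^ g)])) => [|x /SJ];
  last exact: mem_subgroup_gen.
split=> /=.
- by rewrite conj1g.
- by move=> x y; rewrite conjMg; exact: sM.
- by move=> x; rewrite conjVg; exact: sV.
Qed.

End Subgroups.

(** * The union of the upper central series *)

Section UpperCentral.
Variables (G : groupType) (H : set G).
Hypothesis sH : is_subgroup H.
Implicit Types (x y g h z : G).

Fixpoint upper_central m : set G :=
  if m is m'.+1 then [set g | H g /\ forall h, H h -> upper_central m' [~ g, h]]
  else [set 1].

Let H1 : H 1. Proof. by case: sH. Qed.
Let HM x y : H x -> H y -> H (x * y). Proof. by case: sH => _ + _; apply. Qed.
Let HV x : H x -> H x^-1. Proof. by case: sH => _ _; apply. Qed.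
Let HJ x y : H x -> H y -> H (x ^ y). Proof. exact: subgroupJ. Qed.

Lemma upper_central_sub m : upper_central m `<=` H.
Proof. by case: m => [|m] x; [move=> -> | case]. Qed.

Lemma upper_central_subgroup_conj m : is_subgroup (upper_central m) /\
  forall x h, upper_central m x -> H h -> upper_central m (x ^ h).
Proof.
elim: m => [|m [[U1 UM UV] UJ]].
  split; last by move=> x h -> _; rewrite /= conj1g.
  by split=> [//|x y -> ->|x ->]; rewrite /= ?mulg1 ?invg1.
split.
  split.
  - by split=> // h Hh; rewrite comm1g.
  - move=> x y [Hx Ux] [Hy Uy]; split=> [|h Hh]; first exact: HM.
    by rewrite commgMl; apply: UM; [apply: UJ => //; exact: Ux | exact: Uy].
  - move=> x [Hx Ux]; split=> [|h Hh]; first exact: HV.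
    by rewrite (commgVl x h); apply: UJ; [apply/UV/Ux | exact: HV].
move=> x h [Hx Ux] Hh; split=> [|g Hg]; first exact: HJ.
have -> : [~ x ^ h, g] = [~ x, g ^ h^-1] ^ h by group_id.
by apply: UJ => //; apply: Ux; apply: HJ => //; exact: HV.
Qed.

Lemma upper_central_subgroup m : is_subgroup (upper_central m).
Proof. by have [] := upper_central_subgroup_conj m. Qed.

Lemma upper_centralJ m x h : upper_central m x -> H h -> upper_central m (x ^ h).
Proof. by have [_] := upper_central_subgroup_conj m; apply. Qed.

Lemma upper_central_le m k : m <= k -> upper_central m `<=` upper_central k.
Proof.
move=> /subnK <-; elim: (k - m) => // j IH x /IH Ux; rewrite addSn; split.
  exact: upper_central_sub Ux.
move=> h Hh; rewrite commgEl.
have [_ UM UV] := upper_central_subgroup (j + m).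
by apply: UM; [exact: UV | exact: upper_centralJ].
Qed.

(** The lower central series descends at least as fast as the upper one does
when read from [c] downwards. *)
Lemma upper_central_nilpotent c : H `<=` upper_central c -> nilpotent_class_le c H.
Proof.
move=> Hc; have low m : m <= c -> lower_central H m `<=` upper_central (c - m).
  elim: m => [|m IH] mc; first by rewrite subn0.
  apply: subgroup_gen_sub; first exact: upper_central_subgroup.
  move=> _ [x Lx [y Hy <-]].
  have := IH (ltnW mc) x Lx; rewrite -(subnSK mc) => -[_]; exact.
apply/seteqP; split=> [x /(low c (leqnn c))|x ->]; first by rewrite subnn.
exact: lower_central1.
Qed.

Definition hypercenter : set G := [set x | exists m, upper_central m x].
Local Notation Z := hypercenter.

Lemma hypercenter1 : Z 1.
Proof. by exists 0. Qed.

Lemma hypercenterM x y : Z x -> Z y -> Z (x * y).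
Proof.
move=> [m Ux] [k Uy]; exists (maxn m k).
have [_ + _] := upper_central_subgroup (maxn m k); apply.
  exact: upper_central_le (leq_maxl m k) _ Ux.
exact: upper_central_le (leq_maxr m k) _ Uy.
Qed.

Lemma hypercenterV x : Z x -> Z x^-1.
Proof.
by move=> [m Ux]; exists m; have [_ _] := upper_central_subgroup m; apply.
Qed.

Lemma hypercenterJ x h : Z x -> H h -> Z (x ^ h).
Proof. by move=> [m Ux] Hh; exists m; exact: upper_centralJ. Qed.

Lemma hypercenterR x h : Z x -> H h -> Z [~ x, h].
Proof.
move=> Zx Hh; rewrite commgEl; apply: hypercenterM; first exact: hypercenterV.
exact: hypercenterJ.
Qed.

Definition eqz x y := Z (x^-1 * y).

Lemma eqz_refl x : eqz x x.
Proof. by rewrite /eqz mulVg; exact: hypercenter1. Qed.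

Lemma eqz_sym x y : eqz x y -> eqz y x.
Proof. by move=> /hypercenterV; rewrite /eqz invgM invgK. Qed.

Lemma eqz_trans x y z : eqz x y -> eqz y z -> eqz x z.
Proof. by move=> xy yz; have := hypercenterM xy yz; rewrite mulgA mulgK. Qed.

Lemma eqz_mem x y : eqz x y -> Z x -> Z y.
Proof. by move=> xy Zx; have := hypercenterM Zx xy; rewrite mulgA mulgV mul1g. Qed.

Lemma eqz_commg x y h : H x -> H h -> eqz x y -> eqz [~ x, h] [~ y, h].
Proof.
move=> Hx Hh Zz; set z := x^-1 * y in Zz.
have Hz : H z by have [m /upper_central_sub] := Zz.
have -> : y = x * z by rewrite /z mulgA mulgV mul1g.
rewrite /eqz commgMl mulgA; apply: hypercenterM; last exact: hypercenterR.
rewrite -commgEl -(invgR z); apply: hypercenterV.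
apply: hypercenterR => //; exact: subgroupR.
Qed.

Lemma eqz_mulz n x m : H x -> Z n -> Z m -> eqz (n * x * m) x.
Proof.
move=> Hx Zn Zm; apply: eqz_sym; rewrite /eqz !mulgA.
by apply: hypercenterM => //; rewrite -mulgA -conjgE; exact: hypercenterJ.
Qed.

End UpperCentral.

(** * Finitely generated subgroups of a strong set *)

Section Letters.
Variables (G : groupType) (n : nat) (s : 'I_n -> G).
Let H := subgroup_gen (range s).

Let sH : is_subgroup H. Proof. exact: subgroup_gen_subgroup. Qed.

Lemma upper_central_family (f : 'I_n -> G) : (forall i, hypercenter H (f i)) ->
  exists m, forall i, upper_central H m (f i).
Proof.
move=> /choice[m mP]; exists (\max_i m i) => i.
exact: (upper_central_le sH (leq_bigmax i)).
Qed.

(** Finitely many letters: their commutators with [g] lie in one common term of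
the upper central series, and the elements that [g] centralizes modulo this term
form a subgroup. *)
Lemma hypercenter_letters g : H g -> (forall i, hypercenter H [~ g, s i]) ->
  hypercenter H g.
Proof.
move=> Hg /upper_central_family[m Um]; exists m.+1; split=> //.
have [_ UM UV] := upper_central_subgroup sH m; have [h1 hM hV] := sH.
suff : H `<=` [set h | H h /\ upper_central H m [~ g, h]] by move=> h x /h[].
apply: subgroup_gen_sub; last first.
  by move=> _ [i _ <-]; split=> //; apply: mem_subgroup_gen; exists i.
split.
- by split=> //=; rewrite commg1; have [] := upper_central_subgroup sH m.
- move=> x y [Hx Ux] [Hy Uy]; split; first exact: hM.
  by rewrite commgMr; apply: UM => //; exact: (upper_centralJ sH).
- move=> x [Hx Ux]; split; first exact: hV.
  by rewrite (commgVr g x); apply: (upper_centralJ sH) => //; [exact: UV | exact: hV].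
Qed.

Lemma hypercenter_nilpotent : (forall i, hypercenter H (s i)) -> is_nilpotent H.
Proof.
move=> /upper_central_family[m Um]; exists m; apply: (upper_central_nilpotent sH) => //.
by apply: subgroup_gen_sub; [exact: (upper_central_subgroup sH)|move=> _ [i _ <-]].
Qed.

Variable T : set G.
Hypotheses (sT : strong_set T) (TR : forall x y, T x -> T y -> T [~ x, y]).
Hypothesis Ts : forall i, T (s i).

Local Notation Z := (hypercenter H).
Local Notation "x =z y" := (eqz H x y) (at level 70).
Local Notation word := (seq 'I_n).
Implicit Types (d e t x y : G) (u v w p : word).

Let TH : set G := T `&` H.

Let THs i : TH (s i).
Proof. by split=> //; apply: mem_subgroup_gen; exists i. Qed.

Let THR x y : TH x -> TH y -> TH [~ x, y].
Proof. by move=> [Tx Hx] [Ty Hy]; split; [exact: TR | exact: (subgroupR sH)]. Qed.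

(** Expand [[~ d, x * y]] directly and through [x * y = y * x * [~ x, y]]; the
occurrences of [[~ d, y]] are absorbed by [Z], and [[~ d, x]] commutes with
[[~ x, y]] and with [[~ d, x, y]]. *)
Lemma jacobi_hypercenter d x y : TH d -> TH x -> TH y -> Z [~ d, y] ->
  [~ d, [~ x, y]] =z [~ d, x, y].
Proof.
move=> [Td Hd] [Tx Hx] [Ty Hy] Zn.
set k := [~ x, y]; set p := [~ d, x]; set m := [~ d, y] in Zn.
have [_ _ S1 S2] := sT.
have pk : commute p k.
  rewrite /k -(invgR y x); apply: commuteV; apply: commg_commute.
  - exact: S1.
  - exact: S1.
  - exact: S2.
have pyp : commute [~ p, y] p.
  rewrite commgEl; apply: commute_divl; first exact: commute_refl.
  by apply/commute_sym/S1 => //; exact: TR.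
have Hp : H p by exact: (subgroupR sH).
have Hk : H k by exact: (subgroupR sH).
have E1 : [~ d, x * y] = m * (p * [~ p, y]).
  by rewrite commgMr (conjg_mulR p y).
have E2 : [~ d, x * y] = [~ d, k] * (p * m ^ (x * k)).
  rewrite (commgC x y) (commgMr d) -/k (commgMr d) conjMg -/p -/m.
  by rewrite (commute_conj pk) conjgM.
have -> : [~ d, k] = m * [~ p, y] * ((m ^ (x * k))^-1 ^ p^-1).
  move: E2; rewrite E1 -pyp => /esym/(canRL (mulgK _)) ->.
  by group_id.
apply: (eqz_mulz sH) => //; first exact: (subgroupR sH).
have [_ HM HV] := sH.
apply: (hypercenterJ sH) => //; last exact: HV.
by apply/(hypercenterV sH)/(hypercenterJ sH) => //; exact: HM.
Qed.

Definition act d w := foldl (fun e i => [~ e, s i]) d w.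

Lemma act_mem d w : TH d -> TH (act d w).
Proof. by elim: w d => //= i w IH d Td; apply: IH; exact: THR. Qed.

Lemma act_cat d v w : act d (v ++ w) = act (act d v) w.
Proof. exact: foldl_cat. Qed.

Lemma act_hypercenter d w : Z d -> Z (act d w).
Proof.
elim: w d => //= i w IH d Zd; apply: IH; apply: (hypercenterR sH) => //.
by have [] := THs i.
Qed.

(** By induction along [u = p ++ v], with [t] the commutator of the brackets of [p]
and [v]. Since [u] is below its suffix [v], the hypothesis puts [act d v], hence
the commutator of [d] with the bracket of [v], into [Z]: only the first term of
the Jacobi expansion survives. *)
Lemma lyndon_bracket u : lyndon u -> exists2 t, TH t & forall d, TH d ->
  (forall v, split_lt u v -> Z (act d v)) -> [~ d, t] =z act d u.
Proof.
have [m] := ubnP (size u); elim: m u => // m IH u um lu.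
have [u1|u1] := leqP (size u) 1.
  case: u lu u1 {um} => [[]//|i [|//]] _ _.
  by exists (s i) => // d _ _; exact: eqz_refl.
have [p [v [uE lp lv]]] := lyndon_factor lu u1.
have [p0 _] := lp; have [v0 _] := lv.
have um' : size p + size v <= m by rewrite -size_cat -uE.
have uv : split_lt u v by have [_ h] := lu; exact: h uE p0 v0.
have [|x Tx xP] := IH p _ lp.
  by rewrite (leq_trans _ um') // -addn1 leq_add2l; case: (v) v0.
have [|y Ty yP] := IH v _ lv.
  by rewrite (leq_trans _ um') // -add1n leq_add2r; case: (p) p0.
exists [~ x, y] => [|d Td dP]; first exact: THR.
have dy : [~ d, y] =z act d v by apply: yP => // v' /(split_lt_trans uv)/dP.
have Zdy : Z [~ d, y] by exact: (eqz_mem sH (eqz_sym sH dy) (dP _ uv)).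
have dx : [~ d, x] =z act d p.
  apply: xP => // w pw; apply: dP; rewrite uE -[w]cats0; exact: split_lt_catr.
apply: (eqz_trans sH) => //; first exact: jacobi_hypercenter.
apply: (eqz_trans sH (y := [~ act d p, y])).
  by apply: (eqz_commg sH) => //; [have [] := THR Td Tx | have [] := Ty].
rewrite uE act_cat; apply: yP => [|w vw]; first exact: act_mem.
by rewrite -act_cat; apply: dP; rewrite uE split_lt_cat2l.
Qed.

(** [d] stays outside [Z] along [w], each letter being the largest possible. *)
Fixpoint greedy d w : Prop := if w is i :: w' then
    [/\ ~ Z [~ d, s i], forall j : 'I_n, i < j -> Z [~ d, s j] & greedy [~ d, s i] w']
  else True.

Lemma greedy_cat d v w : greedy d (v ++ w) <-> greedy d v /\ greedy (act d v) w.
Proof.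
elim: v d => [|i v IH] d /=; first by split=> [|[]].
split=> [[? ? /IH[? ?]]|[[? ? gv] gw]]; split=> //; exact/IH.
Qed.

Lemma greedy_act d w : ~ Z d -> greedy d w -> ~ Z (act d w).
Proof. by elim: w d => //= i w IH d nd [ndi _ /IH]; exact. Qed.

(** At the first difference [v] has a letter larger than the greedy choice. *)
Lemma greedy_larger d u v : greedy d u -> split_lt u v -> Z (act d v).
Proof.
elim: u v d => [|i u IH] [|j v] d //= [_ h gu] /orP[/h|/andP[/eqP<-]].
  exact: act_hypercenter.
exact: IH.
Qed.

Lemma greedy_language d0 : TH d0 -> ~ Z d0 ->
  language [set w | exists d, [/\ TH d, ~ Z d & greedy d w]].
Proof.
move=> Td0 nd0; split.
- by exists d0.
- move=> v w /infixP[p [q ->]] [d [Td nd]].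
  move=> /greedy_cat[gp /greedy_cat[gv _]]; exists (act d p); split=> //.
    exact: act_mem.
  exact: greedy_act.
- move=> w [d [Td nd gw]].
  have [i0 i0P] : exists i, ~ Z [~ act d w, s i].
    apply/existsNP => all; apply: (greedy_act nd gw).
    by apply: hypercenter_letters => //; have [] := act_mem w Td.
  have /asboolP P0 := i0P.
  have [i /asboolP iP imax] := @arg_maxnP _ i0 (fun i => `[< ~ Z [~ act d w, s i] >])
    (fun i => i : nat) P0.
  exists i; exists d; split=> //; rewrite -cats1; apply/greedy_cat; split=> //=.
  split=> // j ij; apply: contrapT => /asboolP/imax /=.
  by rewrite leqNgt ij.
Qed.

Lemma greedy_bracket u : lyndon u -> exists2 t, TH t & forall d, TH d ->
  greedy d u -> [~ d, t] =z act d u.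
Proof.
move=> /lyndon_bracket[t Tt tP]; exists t => // d Td gu.
by apply: tP => // v; exact: greedy_larger.
Qed.

Lemma commg_cross d e t : TH d -> TH e -> TH t -> Z [~ d, e, t, e].
Proof.
move=> [Td _] [Te _] [Tt _].
have [_ + _] := commg3_commute sT Td Te Tt.
by move=> /commgP/eqP ->; exact: hypercenter1.
Qed.

(** The greedy words would otherwise contain one of the unavoidable patterns, along
which the commutator is trivial modulo [Z]. *)
Lemma strong_sub_hypercenter d : TH d -> Z d.
Proof.
move=> Td; apply: contrapT => nd.
have HTH x : TH x -> H x by case.
have [[e]|[u [e [lu]]]|[u [e [lu]]]] := unavoidable_pattern (greedy_language Td nd).
- move=> [c [Tc nc /(greedy_act nc) /=]]; apply.
  have [Tc' _] := Tc; have [Te _] := THs e.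
  have /commgP/eqP -> := commg_commuter (tame_mem sT Tc') Te.
  exact: hypercenter1.
- move=> [c [Tc nc gc]]; have [t Tt tP] := greedy_bracket lu.
  apply: (greedy_act nc gc).
  have /greedy_cat[gu /= [_ _ gu']] := gc.
  rewrite act_cat /=; set c1 := act c u in gu' *.
  have Tc1 : TH c1 by exact: act_mem.
  apply: (eqz_mem sH (tP _ (THR Tc1 (THs e)) gu')).
  apply: (eqz_mem sH _ (commg_cross Tc Tt (THs e))).
  apply: (eqz_commg sH); [|exact: HTH|].
    by apply: (subgroupR sH); [apply: (subgroupR sH)|]; apply: HTH.
  apply: (eqz_commg sH); [|exact: HTH|exact: tP].
  by apply: (subgroupR sH); apply: HTH.
- move=> [c [Tc nc gc]]; have [t Tt tP] := greedy_bracket lu.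
  apply: (greedy_act nc gc); move: gc; rewrite -cats1 => -[_ _ /greedy_cat[gu _]].
  rewrite /= act_cat /=.
  apply: (eqz_mem sH _ (commg_cross Tc (THs e) Tt)).
  have Tce : TH [~ c, s e] by exact: THR.
  apply: (eqz_commg sH); [|exact: HTH|exact: tP].
  by apply: (subgroupR sH); apply: HTH.
Qed.

Lemma letters_nilpotent : is_nilpotent H.
Proof. by apply: hypercenter_nilpotent => i; exact: strong_sub_hypercenter. Qed.

End Letters.

Lemma strong_locally_nilpotent (G : groupType) (S : set G) (q : seq G) :
  strong_set S -> (forall x, x \in q -> S x) -> is_nilpotent (subgroup_gen [set` q]).
Proof.
move=> sS qS.
have -> : [set` q] = range (tnth (in_tuple q)).
  apply/seteqP; split=> [x /= /(tnthP (in_tuple q))[i ->]|_ [i _ <-]] /=.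
    by exists i.
  exact: mem_tnth.
apply: (letters_nilpotent (T := commutator_closure S)).
- exact: strong_commutator_closure.
- exact: commutator_closure_commg.
- by move=> i; apply/sub_commutator_closure/qS/mem_tnth.
Qed.

(** * Strong left 3-Engel elements *)

Section Engel.
Variables (G : groupType) (a : G).
Hypothesis ha : strong_left_3_Engel a.
Implicit Types f g x y z : G.

Definition conjugates : set G := [set x | exists g, x = a ^ g \/ x = (a ^ g)^-1].

Lemma nilpotent_class_commute c (A : set G) x y : nilpotent_class_le c.+1 (subgroup_gen A) ->
  lower_central (subgroup_gen A) c x -> subgroup_gen A y -> commute x y.
Proof.
move=> nA Lx Ay; have := lower_central_commg Lx Ay.
by rewrite (nA : _ = _) => /= xy; apply/commgP/eqP.
Qed.

Lemma conjugatesJ x g : conjugates x -> conjugates (x ^ g).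
Proof.
move=> [h [->|->]]; exists (h * g); first by left; rewrite conjgM.
by right; rewrite conjVg conjgM.
Qed.

Lemma conjugatesV x : conjugates x -> conjugates x^-1.
Proof. by move=> [h [->|->]]; exists h; [right | left; rewrite invgK]. Qed.

Lemma conjugates_subgroup_gen g x (A : set G) : x = a ^ g \/ x = (a ^ g)^-1 ->
  A (a ^ g) -> subgroup_gen A x.
Proof.
move=> [->|->] Ag; first exact: mem_subgroup_gen.
by have [_ _] := subgroup_gen_subgroup A; apply; exact: mem_subgroup_gen.
Qed.

Lemma engel_commute y : conjugates y -> commute a (a ^ y).
Proof.
have [ha2 _] := ha; move=> [g gy]; set A : set G := [set a; a ^ g].
have Aa : subgroup_gen A a by apply: mem_subgroup_gen; left.
have Ay : subgroup_gen A y by apply: conjugates_subgroup_gen gy _; right.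
rewrite (conjg_mulR a y); apply: commuteM; first exact: commute_refl.
apply: commute_sym; apply: (nilpotent_class_commute (ha2 g) _ Aa).
exact: (@lower_central_commg _ (subgroup_gen A) 0).
Qed.

(** Conjugating by [z^-1], it suffices that [a] commutes with
[(a ^ y) ^ z^-1 = a ^ z^-1 * [~ a, y] * [~ a, y, z^-1]]; the last factor is central
in a group of class 3, and [engel_commute] covers the others. *)
Lemma engel_commute2 y z : conjugates y -> conjugates z ->
  commute (a ^ y) (a ^ z).
Proof.
have [_ ha3] := ha; move=> Cy Cz; apply: commuteJV.
have [f fy] := Cy; have [g gz] := Cz; set A : set G := [set a; a ^ f; a ^ g].
have [A1 AM AV] := subgroup_gen_subgroup A.
have Aa : subgroup_gen A a by apply: mem_subgroup_gen; left; left.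
have Ay : subgroup_gen A y by apply: conjugates_subgroup_gen fy _; left; right.
have Az : subgroup_gen A z by apply: conjugates_subgroup_gen gz _; right.
rewrite (conjg_mulR a y) conjMg (conjg_mulR [~ a, y]); apply: commuteMl.
  exact/commute_sym/engel_commute/conjugatesV.
apply: commuteMl.
  have := engel_commute Cy; rewrite (conjg_mulR a y) => aay.
  apply: commute_sym; have -> : [~ a, y] = a^-1 * (a * [~ a, y]) by rewrite mulKg.
  by apply: commute_divr => //; exact: commute_refl.
apply: (nilpotent_class_commute (ha3 f g)) => //.
apply: lower_central_commg; last exact: AV.
exact: (@lower_central_commg _ (subgroup_gen A) 0).
Qed.

Lemma strong_conjugates : strong_set conjugates.
Proof.
have conjE h y : (a ^ h) ^ y = (a ^ (y ^ h^-1)) ^ h by rewrite -!conjgM; congr (a ^ _); group_id.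
split.
- exact: conjugatesJ.
- exact: conjugatesV.
- move=> x y Cx Cy; have [h xE] := Cx.
  have c : commute (a ^ h) ((a ^ h) ^ y).
    by rewrite conjE; apply/commuteJ/engel_commute/conjugatesJ.
  by case: xE => ->; rewrite ?conjVg //; apply/commuteVl/commuteV.
- move=> x y z Cx Cy Cz; have [h xE] := Cx.
  have c : commute ((a ^ h) ^ y) ((a ^ h) ^ z).
    by rewrite (conjE h y) (conjE h z); apply/commuteJ/engel_commute2; exact: conjugatesJ.
  by case: xE => ->; rewrite ?conjVg //; apply/commuteVl/commuteV.
Qed.

Lemma normal_closure_sub : normal_closure (subgroup_gen [set a]) `<=` subgroup_gen conjugates.
Proof.
apply: smallest_sub.
  split; first exact: subgroup_gen_subgroup.
  by move=> x g; apply: subgroup_gen_conj => y; exact: conjugatesJ.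
apply: subgroup_genS => _ ->; exists 1; left; by rewrite conjg1.
Qed.

End Engel.

Theorem theorem1p2 (G : groupType) (a : G) (ha : strong_left_3_Engel a) :
  locally_nilpotent (normal_closure (subgroup_gen (set1 a))).
Proof.
move=> K sK KN [A /finite_seqP[p ->] KE].
have [q [qS pq]] : exists q : seq G, (forall x, x \in q -> conjugates a x) /\
    forall x, x \in p -> subgroup_gen [set` q] x.
  apply: subgroup_gen_finite_seq => x xp.
  have Kx : K x by rewrite KE; exact: mem_subgroup_gen.
  exact: normal_closure_sub (KN x Kx).
apply: (is_nilpotentS sK) (strong_locally_nilpotent (strong_conjugates ha) qS).
rewrite KE; apply: subgroup_gen_sub; first exact: subgroup_gen_subgroup.
exact: pq.
Qed.
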